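(* Let $q \ge 2$ be a prime power, let $(\varepsilon_d : d \in \mathcal{D}_q)$ be a probability vector indexed by the set $\mathcal{D}_q$ of positive divisors of $q$, and let $(V_n : n \in \mathbb{N}_0)$ be the polarization process with initial channel $V_0 = V_{(q)}(\varepsilon_d : d \in \mathcal{D}_q)$. Then $V_n$ converges almost surely, as $n \to \infty$, to a random channel $V_\infty$ of the form $V_{(q)}(\cdot)$ (i.e., writing $V_n = V_{(q)}(E_{d,n} : d \in \mathcal{D}_q)$, the random probability vectors $(E_{d,n} : d \in \mathcal{D}_q)$ converge almost surely to a random probability vector $(E_{d,\infty} : d \in \mathcal{D}_q)$, and $V_\infty = V_{(q)}(E_{d,\infty} : d \in \mathcal{D}_q)$) such that, for every $d \in \mathcal{D}_q$, $$\Pr\Big( \forall \alpha \in [0,\infty],\ I_\alpha(V_\infty) = \ln d \Big) = \varepsilon_d .$$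
   Context: **Channels.** $\mathbb{Z}_q = \{0,1,\dots,q-1\}$. A channel $W : \mathbb{Z}_q \to \mathcal{Y}$ with finite output alphabet $\mathcal{Y}$ is a family of conditional probabilities $W(y \mid x)$. **Symmetric capacity of order $\alpha$.** For $\alpha \in (0,1)\cup(1,\infty)$, $$I_\alpha(W) = \frac{\alpha}{\alpha-1} \ln \Bigg[ \sum_{y \in \mathcal{Y}} \Big( \sum_{x \in \mathbb{Z}_q} \tfrac{1}{q} W(y \mid x)^\alpha \Big)^{1/\alpha} \Bigg],$$ and for $\alpha\in\{0,1,\infty\}$ it is defined by limits: $I_0(W) = \lim_{\alpha\to 0^+} I_\alpha(W) = \min_{y} \ln \frac{q}{|\{x \in \mathbb{Z}_q : W(y\mid x) > 0\}|}$ (outputs $y$ with $W(y\mid x)=0$ for all $x$ are ignored), $I_1(W) = \lim_{\alpha \to 1} I_\alpha(W) = \sum_{y}\sum_{x} \frac1q W(y\mid x) \ln \frac{W(y\mid x)}{\sum_{x'} \frac1q W(y \mid x')}$, $I_\infty(W) = \lim_{\alpha\to\infty} I_\alpha(W) = \ln \sum_{y} \max_{x} W(y\mid x)$. **Generalized erasure channel.** $\mathcal{D}_q$ is the set of positive divisors of $q$. For $d \in \mathbb{N}$ and $r \in \mathbb{Z}$, $[r]_d = \{ z \in \mathbb{Z} : z \equiv r \pmod d\}$ and $\mathbb{Z}/d\mathbb{Z} = \{[r]_d : r \in \mathbb{Z}\}$. Given $\varepsilon_d \ge 0$ ($d\in\mathcal{D}_q$) with $\sum_{d \in \mathcal{D}_q}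 \varepsilon_d = 1$, the channel $V_{(q)}(\varepsilon_d : d \in \mathcal{D}_q)$ has input alphabet $\mathbb{Z}_q$, output alphabet $\mathcal{Y} = \bigcup_{d \in \mathcal{D}_q} (\mathbb{Z}/d\mathbb{Z})$ (a disjoint union), and transition probabilities $V(y \mid x) = \varepsilon_d$ if $y = [x]_d$ for some $d \in \mathcal{D}_q$, and $V(y\mid x) = 0$ otherwise. **Polar transformation.** Fix $\gamma \in \mathbb{Z}_q$ with $\gcd(\gamma,q)=1$ and put $f_\gamma(u_1,u_2) = u_1 + \gamma u_2 \bmod q$. A channel $W$ is mapped to $W^0(y_1,y_2 \mid u_1) = \sum_{u_2 \in \mathbb{Z}_q} \frac1q W(y_1 \mid f_\gamma(u_1,u_2)) W(y_2 \mid u_2)$ and $W^1(y_1,y_2,u_1 \mid u_2) = \frac1q W(y_1 \mid f_\gamma(u_1,u_2)) W(y_2 \mid u_2)$. For $V = V_{(q)}(\varepsilon_d : d \in \mathcal{D}_q)$, the channels $V^0$ and $V^1$ are identified with the channels to which they are equivalent (same $I_\alpha$ for all $\alpha\in[0,\infty]$ for the channel itself and all its iterated polar transforms), namely $V^0 = V_{(q)}(\varepsilon_d^- : d \in \mathcal{D}_q)$ and $V^1 = V_{(q)}(\varepsilon_d^+ : d \in \mathcal{D}_q)$, where $$\varepsilon_d^- = \sum_{d_1,d_2 \in \mathcal{D}_q : \gcd(d_1,d_2)=d} \varepsilon_{d_1}\varepsilon_{d_2}, \qquad \varepsilon_d^+ = \sum_{d_1,d_2 \in \mathcal{D}_q :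 \mathrm{lcm}(d_1,d_2)=d} \varepsilon_{d_1}\varepsilon_{d_2}.$$ **Polarization process.** Let $B_1, B_2, \dots$ be i.i.d. random variables uniform on $\{0,1\}$. Set $V_0 = V$ (the initial channel) and $V_n = V_{n-1}^{B_n}$ for $n \ge 1$. With the identification above, $V_n = V_{(q)}(E_{d,n} : d \in \mathcal{D}_q)$, where $(E_{d,0}) = (\varepsilon_d)$ and $(E_{d,n})$ is obtained from $(E_{d,n-1})$ by the map $(\varepsilon_d) \mapsto (\varepsilon_d^-)$ if $B_n = 0$ and by $(\varepsilon_d)\mapsto(\varepsilon_d^+)$ if $B_n = 1$. *)

(* Defs.v *)
From HB Require Import structures.
From mathcomp Require Import all_boot all_order all_algebra.
From mathcomp Require Import all_classical all_reals all_analysis.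
Set Implicit Arguments.
Unset Strict Implicit.
Unset Printing Implicit Defensive.
Import Order.TTheory GRing.Theory Num.Theory numFieldNormedType.Exports.
Local Open Scope classical_set_scope.
Local Open Scope ring_scope.

Definition prime_power (q : nat) : Prop :=
  exists p k : nat, [/\ prime p, (0 < k)%N & q = (p ^ k)%N].

(* Transition probabilities: [W x y] stands for W(y | x). *)
Definition channel (R : realType) (q : nat) (Y : finType) := 'I_q -> Y -> R.

Definition sym_capacity_real (R : realType) (q : nat) (Y : finType)
    (W : channel R q Y) (a : R) : R :=
  a / (a - 1) *
  ln (\sum_(y : Y) (\sum_(x < q) q%:R^-1 * W x y `^ a) `^ a^-1).

(* Orders 0, 1 and +oo are the limits of the generic orders.  The value at
   negative orders is irrelevant. *)
Definition sym_capacity (R : realType) (q : nat) (Y : finType)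
    (W : channel R q Y) (alpha : \bar R) : R :=
  match alpha with
  | a%:E => if a == 0 then lim (sym_capacity_real W b @[b --> 0^'+])
            else if a == 1 then lim (sym_capacity_real W b @[b --> (1 : R)^'])
            else sym_capacity_real W a
  | +oo%E => lim (sym_capacity_real W b @[b --> +oo])
  | -oo%E => 0
  end.

Definition divisor (q : nat) : finType := seq_sub (divisors q).

(* The disjoint union of the Z/dZ, d | q: the residue class [r]_d is
   represented by its element in {0, ..., d - 1}. *)
Definition erasure_output (q : nat) : finType := {d : divisor q & 'I_(val d)}.

Definition erasure_channel (R : realType) (q : nat) (eps : divisor q -> R) :
    channel R q (erasure_output q) :=
  fun x y => if val (tagged y) == (x %% val (tag y))%N then eps (tag y) else 0.

Definition prob_vector (R : realType) (I : finType) (e : I -> R) : Prop :=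
  (forall i, 0 <= e i) /\ \sum_i e i = 1.

(* The polar transforms of the erasure channel with parameters [eps] are
   identified with the erasure channels with parameters [polar_minus eps]
   and [polar_plus eps]; these do not depend on the unit gamma in the kernel
   (u1, u2) |-> u1 + gamma * u2. *)
Definition polar_minus (R : realType) (q : nat) (eps : divisor q -> R)
    (d : divisor q) : R :=
  \sum_(d1 : divisor q)
    \sum_(d2 : divisor q | gcdn (val d1) (val d2) == val d) eps d1 * eps d2.

Definition polar_plus (R : realType) (q : nat) (eps : divisor q -> R)
    (d : divisor q) : R :=
  \sum_(d1 : divisor q)
    \sum_(d2 : divisor q | lcmn (val d1) (val d2) == val d) eps d1 * eps d2.

(* [b n] drives the step from time n to time n + 1; true stands for 1. *)
Fixpoint polarization (R : realType) (q : nat) (eps : divisor q -> R)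
    (b : nat -> bool) (n : nat) : divisor q -> R :=
  if n is n'.+1 then
    if b n' then polar_plus (polarization eps b n')
    else polar_minus (polarization eps b n')
  else eps.

Definition mutually_independent (R : realType) (d d' : measure_display)
    (T : measurableType d) (T' : measurableType d') (P : probability T R)
    (X : nat -> {RV P >-> T'}) : Prop :=
  forall (J : seq nat) (A : nat -> set T'),
    uniq J -> (forall j, measurable (A j)) ->
    P (\bigcap_(j in [set` J]) (X j @^-1` A j)) =
    (\prod_(j <- J) P (X j @^-1` A j))%E.

Definition fair_bit (R : realType) (d : measure_display)
    (T : measurableType d) (P : probability T R) (X : {RV P >-> bool}) : Prop :=
  forall c : bool, P (X @^-1` [set c]) = (2^-1)%:E.

(* Main.v *)
(** For a prime power [q] the divisors are totally ordered by divisibility, so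
    [gcd] and [lcm] return the two arguments in some order.  Hence the tail
    [Z = \sum_(c %| d) e d] behaves like the parameter of a binary erasure
    channel: a fair bit sends it to [Z^2] or to [2 Z - Z^2].  For
    [h = Z (1 - Z)] the mean over one step is [h - h^2], so the expectations of
    [h_n^2] are summable and [h_n -> 0] almost surely; since each step of [Z] has
    size exactly [h], [Z] cannot jump between neighbourhoods of 0 and 1 and
    therefore converges to one of them.  Differences of consecutive tails
    then show that the probability vectors converge to a unit vector at a random
    divisor.  As every coordinate is a bounded martingale, that divisor is [d] with
    probability [eps d], and the limit channel transmits [x] modulo it without
    noise. *)
Require Import Defs.
From HB Require Import structures.
From mathcomp Require Import all_boot all_order all_algebra.
From mathcomp Require Import all_classical all_reals all_analysis.
From mathcomp Require Import measurable_realfun.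
From mathcomp Require Import ring lra.
Set Implicit Arguments.
Unset Strict Implicit.
Unset Printing Implicit Defensive.

Import Order.TTheory GRing.Theory Num.Theory numFieldNormedType.Exports.
Local Open Scope classical_set_scope.
Local Open Scope ring_scope.

(** * Tails of the polar transforms *)

Lemma val_divisor_dvd (q : nat) (d : divisor q) : (0 < q)%N -> (val d %| q)%N.
Proof. by move=> q0; rewrite dvdn_divisors //; exact: valP. Qed.

(** Both divisors are powers of the same prime, so comparing exponents decides divisibility. *)
Lemma prime_power_divisor_comparable (q : nat) (d1 d2 : divisor q) :
  prime_power q -> (val d1 %| val d2)%N || (val d2 %| val d1)%N.
Proof.
move=> [p [k [pp _ qE]]].
have q0 : (0 < q)%N by rewrite qE expn_gt0 prime_gt0.
have /(dvdn_pfactor _ _ pp)[i _ ->] : (val d1 %| p ^ k)%N.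
  by rewrite -qE val_divisor_dvd.
have /(dvdn_pfactor _ _ pp)[j _ ->] : (val d2 %| p ^ k)%N.
  by rewrite -qE val_divisor_dvd.
by case/orP: (leq_total i j) => /(dvdn_exp2l p) ->; rewrite ?orbT.
Qed.

(** The index [c] is any natural number, so that [p * val d] is allowed even for [val d = q], where
    the tail is empty and equals 0. *)
Definition tail (R : realType) (q : nat) (e : divisor q -> R) (c : nat) : R :=
  \sum_(d : divisor q | (c %| val d)%N) e d.

(** Each pair [(i, j)] lies over exactly one [d], the one with [g d = f i j], so summing over the
    fibres lists every pair once. *)
Lemma sum_mul_fibers (R : realType) (I : finType) (f : I -> I -> nat)
    (A : nat -> bool) (e : I -> R) (g : I -> nat) :
  injective g -> (forall i j, exists k, f i j = g k) ->
  \sum_(d | A (g d)) \sum_i \sum_(j | f i j == g d) e i * e j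
  = \sum_i \sum_(j | A (f i j)) e i * e j.
Proof.
move=> ginj fg; rewrite exchange_big /=; apply: eq_bigr => i _.
under eq_bigr do rewrite big_mkcond.
rewrite exchange_big /= [RHS]big_mkcond; apply: eq_bigr => j _.
have [k fk] := fg i j.
rewrite fk -big_mkcondr /=; case: ifP => Ak.
  rewrite (big_pred1 k) // => d /=.
  by rewrite (inj_eq ginj) eq_sym; case: eqVneq => [->|_]; rewrite ?Ak ?andbF.
rewrite big1 // => d /andP[Ad /eqP/ginj kd].
by move: Ad; rewrite -kd Ak.
Qed.

Lemma ex_divisor (q n : nat) :
  (0 < q)%N -> (n %| q)%N -> exists d : divisor q, n = val d.
Proof.
move=> q0 nq; have nD : n \in divisors q by rewrite -dvdn_divisors.
by exists (SeqSub nD).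
Qed.

Lemma prime_power_gt0 (q : nat) : prime_power q -> (0 < q)%N.
Proof. by move=> [p [k [pp _ ->]]]; rewrite expn_gt0 prime_gt0. Qed.

(** [c] divides a gcd iff it divides both arguments, so the double sum factors into a square. *)
Lemma tail_polar_minus (R : realType) (q : nat) (e : divisor q -> R) (c : nat) :
  (0 < q)%N -> tail (polar_minus e) c = tail e c ^+ 2.
Proof.
move=> q0; rewrite /tail (@sum_mul_fibers _ _ (fun d1 d2 => gcdn (val d1) (val d2))
  (dvdn c) e val val_inj); last first.
  move=> d1 d2; apply: ex_divisor => //.
  exact: dvdn_trans (dvdn_gcdl _ _) (val_divisor_dvd _ _).
rewrite expr2 mulr_suml [RHS]big_mkcond; apply: eq_bigr => d1 _.
under eq_bigl do rewrite dvdn_gcd.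
by case: ifP => cd1 /=; rewrite ?mulr_sumr ?big_pred0_eq.
Qed.

(* [{gcd d1 d2, lcm d1 d2} = {d1, d2}], so the two sums together count each
   [e d1 * e d2] once for [d1 = d] and once for [d2 = d]. *)
Lemma polar_minusDplus (R : realType) (q : nat) (e : divisor q -> R)
    (d : divisor q) :
  prime_power q -> \sum_i e i = 1 ->
  polar_minus e d + polar_plus e d = 2 * e d.
Proof.
move=> hq e1; rewrite /polar_minus /polar_plus -big_split /=.
have step d1 d2 : (if gcdn (val d1) (val d2) == val d then e d1 * e d2 else 0) +
    (if lcmn (val d1) (val d2) == val d then e d1 * e d2 else 0) =
    (if d1 == d then e d1 * e d2 else 0) + (if d2 == d then e d1 * e d2 else 0).
  case/orP: (prime_power_divisor_comparable d1 d2 hq) => d12.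
    by rewrite (gcdn_idPl d12) (lcmn_idPr d12) !(inj_eq val_inj).
  by rewrite (gcdn_idPr d12) (lcmn_idPl d12) !(inj_eq val_inj) addrC.
transitivity (\sum_d1 ((if d1 == d then e d1 else 0) + e d1 * e d)).
  apply: eq_bigr => d1 _; rewrite big_mkcond [X in _ + X = _]big_mkcond -big_split /=.
  under eq_bigr do rewrite step.
  rewrite big_split /= -[X in _ + X]big_mkcond.
  rewrite big_pred1_eq; congr (_ + _); case: ifP => _; last exact: big1.
  by rewrite -mulr_sumr e1 mulr1.
by rewrite big_split -big_mkcond /= big_pred1_eq -mulr_suml e1 mul1r mulr_natl.
Qed.

Lemma polar_minus_ge0 (R : realType) (q : nat) (e : divisor q -> R) d :
  (forall i, 0 <= e i) -> 0 <= polar_minus e d.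
Proof. by move=> e0; do 2!apply: sumr_ge0 => ? _; rewrite mulr_ge0. Qed.

Lemma polar_plus_ge0 (R : realType) (q : nat) (e : divisor q -> R) d :
  (forall i, 0 <= e i) -> 0 <= polar_plus e d.
Proof. by move=> e0; do 2!apply: sumr_ge0 => ? _; rewrite mulr_ge0. Qed.

Lemma tail1 (R : realType) (q : nat) (e : divisor q -> R) :
  tail e 1 = \sum_i e i.
Proof. by apply: eq_bigl => i; rewrite dvd1n. Qed.

(** The two transforms add up to [2 * e] coordinatewise, so this tail is [2 * tail e c] minus the
    tail of the minus transform. *)
Lemma tail_polar_plus (R : realType) (q : nat) (e : divisor q -> R) (c : nat) :
  prime_power q -> \sum_i e i = 1 ->
  tail (polar_plus e) c = 2 * tail e c - tail e c ^+ 2.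
Proof.
move=> hq e1; apply/eqP; rewrite eq_sym subr_eq addrC.
rewrite -(tail_polar_minus _ _ (prime_power_gt0 hq)) /tail mulr_sumr -big_split.
by apply/eqP/eq_bigr => d _ /=; rewrite polar_minusDplus.
Qed.

Lemma prob_vector_polarization (R : realType) (q : nat) (e : divisor q -> R)
    (b : nat -> bool) (n : nat) :
  prime_power q -> prob_vector e -> prob_vector (polarization e b n).
Proof.
move=> hq he; elim: n => [//|n [e0 e1]] /=; have q0 := prime_power_gt0 hq.
case: (b n); split=> [d|].
- exact: polar_plus_ge0.
- by rewrite -tail1 tail_polar_plus // tail1 e1; ring.
- exact: polar_minus_ge0.
- by rewrite -tail1 tail_polar_minus // tail1 e1 expr1n.
Qed.

Lemma tail_ge0_le1 (R : realType) (q : nat) (e : divisor q -> R) (c : nat) :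
  prob_vector e -> 0 <= tail e c <= 1.
Proof.
move=> [e0 e1]; rewrite sumr_ge0 //= -e1 /tail big_mkcond /=.
by apply: ler_sum => d _; case: ifP.
Qed.

Lemma polarization_ext (R : realType) (q : nat) (e : divisor q -> R)
    (b b' : nat -> bool) (n : nat) :
  (forall i, (i < n)%N -> b i = b' i) -> polarization e b n = polarization e b' n.
Proof.
elim: n => [//|n IHn] bb' /=; rewrite bb' // IHn // => i ni.
by rewrite bb' // ltnW.
Qed.

(** Among the powers of [p], the only multiple of [p ^ i] that is not a multiple of [p ^ i.+1] is
    [p ^ i] itself. This recovers a coordinate from two tails. *)
Lemma tail_sub (R : realType) (q p k : nat) (e : divisor q -> R) (d : divisor q) :
  prime p -> q = (p ^ k)%N -> tail e (val d) - tail e (p * val d) = e d.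
Proof.
move=> pp qE; rewrite qE in e d *; have p0 := prime_gt0 pp.
have q0 : (0 < p ^ k)%N by rewrite expn_gt0 p0.
apply/eqP; rewrite subr_eq /tail (bigD1 d) //=; apply/eqP; congr (_ + _).
apply: eq_bigl => d'; have [dk d'k] := (val_divisor_dvd d q0, val_divisor_dvd d' q0).
have /(dvdn_pfactor _ _ pp)[i _ di] := dk.
have /(dvdn_pfactor _ _ pp)[j _ dj] := d'k.
have -> : (d' == d) = (p ^ j == p ^ i)%N by rewrite -di -dj.
rewrite [val d]di [val d']dj -expnS !dvdn_Pexp2l ?eqn_exp2l ?prime_gt1 //.
by rewrite [RHS]ltn_neqAle andbC eq_sym.
Qed.

(** * Convergence of sequences with steps at most z (1 - z) *)

Lemma cvg0_of_small_steps (R : realType) (z : nat -> R) :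
  (forall n, 0 <= z n) ->
  (forall n, `|z n.+1 - z n| <= z n * (1 - z n)) ->
  (forall n, z n * (1 - z n) < 8^-1) ->
  z n * (1 - z n) @[n --> \oo] --> (0 : R) ->
  z 0%N <= 2^-1 -> z n @[n --> \oo] --> (0 : R).
Proof.
move=> z0 dz hz hz0 zh.
(* If [z <= 1/2] and [z (1 - z) < 1/8], then [z] is below 0.15, and a step shorter than 1/8 cannot
   carry it past 1/2. *)
have zle n : z n <= 2^-1.
  elim: n => // n IHn; have := dz n; have := hz n; have := z0 n.
  by rewrite ler_norml => ? ? /andP[_ ?]; nra.
(* For [z <= 1/2] the factor [1 - z] is at least 1/2, whence [z <= 2 z (1 - z)]. *)
apply: (@squeeze_cvgr _ _ _ _ (fun=> 0) (fun n => 2 * (z n * (1 - z n)))).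
- by apply: nearW => n; rewrite z0 /=; have := zle n; have := z0 n; nra.
- exact: cvg_cst.
- by rewrite -[X in _ --> X](mulr0 2); apply: cvgM => //; exact: cvg_cst.
Qed.

(** From some index [N] on, [z (1 - z) < 1/8]. The hypotheses are symmetric under [z |-> 1 - z], so
    the previous lemma applies to the shifted sequence or to its complement, according to the side
    of 1/2 on which [z N] lies. *)
Lemma cvg01_of_small_steps (R : realType) (z : nat -> R) :
  (forall n, 0 <= z n <= 1) ->
  (forall n, `|z n.+1 - z n| <= z n * (1 - z n)) ->
  z n * (1 - z n) @[n --> \oo] --> (0 : R) ->
  z n @[n --> \oo] --> (0 : R) \/ z n @[n --> \oo] --> (1 : R).
Proof.
move=> z01 dz hz0.
have [N _ hN] : \forall n \near \oo, z n * (1 - z n) < 8^-1.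
  by apply: (cvgr_lt (0 : R)) => //; rewrite invr_gt0 ltr0n.
have zN0 n : 0 <= z (n + N)%N by have /andP[] := z01 (n + N)%N.
have zN1 n : 0 <= 1 - z (n + N)%N by rewrite subr_ge0; have /andP[] := z01 (n + N)%N.
have hzN : z (n + N)%N * (1 - z (n + N)%N) @[n --> \oo] --> (0 : R).
  by rewrite -(cvg_shiftn N) in hz0.
have hN' n : z (n + N)%N * (1 - z (n + N)%N) < 8^-1 by apply: hN; rewrite /= leq_addl.
have dzN n : `|z (n.+1 + N)%N - z (n + N)%N| <= z (n + N)%N * (1 - z (n + N)%N).
  exact: dz.
have [zh|zh] := leP (z N) 2^-1.
  left; rewrite -(cvg_shiftn N).
  exact: (@cvg0_of_small_steps _ (fun n => z (n + N)%N)).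
right; rewrite -(cvg_shiftn N).
have : 1 - z (n + N)%N @[n --> \oo] --> (0 : R).
  apply: (@cvg0_of_small_steps _ (fun n => 1 - z (n + N)%N)) => //.
  - move=> n; rewrite subKr [leRHS]mulrC -normrN.
    by rewrite (_ : - (_ - _ - _) = z (n.+1 + N)%N - z (n + N)%N) //; ring.
  - by move=> n; rewrite subKr mulrC.
  - rewrite [X in X @ _](_ : _ = fun n => z (n + N)%N * (1 - z (n + N)%N)) //.
    by apply/funext => n; rewrite subKr mulrC.
  - by rewrite add0n; lra.
move=> /(cvgB (cvg_cst (1 : R))); rewrite subr0; apply: cvg_trans.
rewrite [X in _ --> X @ _](_ : _ = fun n => z (n + N)%N) //.
by apply/funext => n /=; rewrite subKr.
Qed.

(** * Capacity of a noiseless erasure channel *)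

Definition unit_vector (R : realType) (q : nat) (d : divisor q) :
  divisor q -> R := fun d' => (d' == d)%:R.

Lemma sum_modn_eq (R : realType) (n d r : nat) : (r < d)%N -> (d %| n)%N ->
  \sum_(x < n) ((x %% d)%N == r)%:R = (n %/ d)%:R :> R.
Proof.
move=> rd /dvdnP[m ->]; rewrite mulnK ?(leq_ltn_trans _ rd) //.
elim: m => [|m IHm]; first by rewrite mul0n big_ord0.
rewrite mulSn big_split_ord /= [in RHS]mulrS -{}IHm; congr (_ + _); last first.
  by apply: eq_bigr => x _; rewrite modnDl.
rewrite (bigD1 (Ordinal rd)) //= modn_small // eqxx big1 ?addr0 // => i ir.
by rewrite modn_small // (_ : (_ == _) = false) //; apply/negbTE.
Qed.

(** Only the [d] residue classes modulo [d] occur as outputs, each from [q / d] inputs. The inner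
    sums are therefore [1 / d], the outer sum is [d * d^(-1/a)], and the prefactor [a / (a - 1)]
    cancels the factor [1 - 1/a] of its logarithm. *)
Lemma sym_capacity_real_unit_vector (R : realType) (q : nat) (d : divisor q)
    (a : R) : (0 < q)%N -> a != 0 -> a != 1 ->
  sym_capacity_real (erasure_channel (unit_vector R d)) a = ln (val d)%:R.
Proof.
move=> q0 a0 a1.
have dq : (val d %| q)%N by rewrite dvdn_divisors //; exact: valP.
have d0 : (0 < val d)%N by apply: dvdn_gt0 dq.
pose D : R := (val d)%:R.
have D0 : 0 < D by rewrite ltr0n.
rewrite /sym_capacity_real.
(* Since [powR] sets 0 to the power 0 equal to 1, null terms vanish only because both exponents [a]
   and [a^-1] are nonzero. *)
have aI : a^-1 != 0 by rewrite invr_eq0.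
have -> : \sum_(y : erasure_output q) (\sum_(x < q) q%:R^-1 *
    erasure_channel (unit_vector R d) x y `^ a) `^ a^-1 = D * D^-1 `^ a^-1.
  rewrite -(@sig_big_dep _ _ _ (divisor q) (fun d => 'I_(val d)) xpredT
    (fun _ => xpredT) (fun d' r => (\sum_(x < q) q%:R^-1 *
      erasure_channel (unit_vector R d) x (Tagged (fun d => 'I_(val d)) r) `^ a) `^ a^-1)) /=.
  rewrite (bigD1 d) //= [X in _ + X]big1 ?addr0; last first.
    move=> d' /negbTE d'd; apply: big1 => r _.
    rewrite big1 ?powR0 // => x _.
    by rewrite /erasure_channel /unit_vector /= d'd if_same powR0 ?mulr0.
  transitivity (\sum_(r < val d) D^-1 `^ a^-1); last first.
    by rewrite sumr_const card_ord mulr_natl.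
  apply: eq_bigr => r _; congr (_ `^ _).
  rewrite -mulr_sumr.
  under eq_bigr => x _.
    have -> : erasure_channel (unit_vector R d) x
        (Tagged (fun d => 'I_(val d)) r) `^ a = ((x %% val d)%N == r)%:R.
      rewrite /erasure_channel /unit_vector /= eqxx.
      rewrite [RHS](_ : _ = (val r == (x %% val d)%N)%:R); last by rewrite eq_sym.
      by case: ifP => _; rewrite ?powR1 ?powR0.
  over.
  move/divnK: (dq) => qE.
  rewrite sum_modn_eq // -[X in X%:R^-1]qE natrM invfM.
  rewrite mulrAC mulVf ?mul1r // pnatr_eq0 -lt0n divn_gt0 //.
  exact: dvdn_leq.
rewrite lnM ?posrE ?powR_gt0 ?invr_gt0 // ln_powR lnV ?posrE //.
have a10 : a - 1 != 0 by rewrite subr_eq0.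
by field; rewrite a0 a10.
Qed.

(** The generic formula is constant away from 0 and 1, and near each of 0, 1 and [+oo] the limiting
    filter avoids these two points. *)
Lemma sym_capacity_unit_vector (R : realType) (q : nat) (d : divisor q)
    (alpha : \bar R) : (0 < q)%N -> (0 <= alpha)%E ->
  sym_capacity (erasure_channel (unit_vector R d)) alpha = ln (val d)%:R.
Proof.
move=> q0; pose f := sym_capacity_real (erasure_channel (unit_vector R d)).
have fE b : b != 0 -> b != 1 -> f b = ln (val d)%:R.
  by move=> b0 b1; exact: sym_capacity_real_unit_vector.
have flim (F : set_system R) : ProperFilter F ->
    (\forall b \near F, b != 0 /\ b != 1) -> lim (f b @[b --> F]) = ln (val d)%:R.
  move=> FF Fb; apply: cvg_lim => //; apply: cvg_near_cst.
  by apply: filterS Fb => b [b0 b1]; rewrite fE.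
case: alpha => [a| |] //= a0.
- case: eqVneq => [_|an0].
    apply: flim; near=> b; split; first by rewrite gt_eqF.
    by rewrite lt_eqF //; near: b; exact: nbhs_right_lt.
  case: eqVneq => [_|an1]; last exact: fE.
  apply: flim; near=> b; split; last by near: b; exact: nbhs_dnbhs_neq.
  rewrite gt_eqF //; near: b; apply: nbhs_dnbhs; exact: lt_nbhsr.
- apply: flim; near=> b; have : 1 < b by near: b; apply: nbhs_pinfty_gt; rewrite num_real.
  by move=> b1; split; rewrite gt_eqF // (lt_trans _ b1).
Unshelve. all: by end_near. Qed.

(** * Cylinders of fair bits *)

(** The event that the bits begin with [s]; the default [false] of [nth] is never read. *)
Definition cylinder (T : Type) (B : nat -> T -> bool) (s : seq bool) : set T :=
  [set w | forall i, (i < size s)%N -> B i w = nth false s i].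

Lemma cylinder_rcons (T : Type) (B : nat -> T -> bool) (s : seq bool) (c : bool) :
  cylinder B (rcons s c) = cylinder B s `&` B (size s) @^-1` [set c].
Proof.
apply/seteqP; split=> [w Cw|w [Cw Bw] i].
  split=> [i ins|]; last first.
    by have := Cw (size s); rewrite size_rcons ltnSn nth_rcons ltnn eqxx; exact.
  by have := Cw i; rewrite size_rcons nth_rcons ins ltnS ltnW //; exact.
rewrite size_rcons ltnS nth_rcons => ins; case: ltnP => [/Cw//|sn].
have -> : i = size s by apply/eqP; rewrite eqn_leq ins sn.
by rewrite eqxx.
Qed.

Lemma cylinder_bigcap (T : Type) (B : nat -> T -> bool) (s : seq bool) :
  cylinder B s = \bigcap_(j in [set` iota 0 (size s)])
                     (B j @^-1` [set nth false s j]).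
Proof.
apply/seteqP; split=> w Cw i /=.
  by rewrite mem_iota add0n => /Cw.
by move=> ins; apply: (Cw i); rewrite /= mem_iota.
Qed.

Section fair_bits.
Context (R : realType) (disp : measure_display) (T : measurableType disp)
  (P : probability T R) (B : nat -> {RV P >-> bool}).
Hypotheses (hBfair : forall n, fair_bit (B n)) (hBindep : mutually_independent B).

Let cyl := cylinder (fun n w => B n w).

Lemma measurable_bit n c : measurable (B n @^-1` [set c]).
Proof. by rewrite -[X in measurable X]setTI; exact: measurable_funP. Qed.

Lemma measurable_cylinder s : measurable (cyl s).
Proof.
rewrite /cyl cylinder_bigcap; apply: bigcap_measurableType => j _.
exact: measurable_bit.
Qed.

Lemma prob_cylinder s : P (cyl s) = (2^-1 ^+ size s)%:E.
Proof.
rewrite /cyl cylinder_bigcap hBindep ?iota_uniq //.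
under eq_bigr do rewrite hBfair.
by rewrite prodEFin big_const_seq count_predT size_iota -Monoid.iteropE.
Qed.

Lemma integral_cylinder_rcons s (f : T -> R) :
  measurable_fun setT f -> (forall w, 0 <= f w) ->
  (\int[P]_(w in cyl s) (f w)%:E =
   \int[P]_(w in cyl (rcons s true)) (f w)%:E +
   \int[P]_(w in cyl (rcons s false)) (f w)%:E)%E.
Proof.
move=> mf f0; rewrite -ge0_integral_setU; try exact: measurable_cylinder.
- congr (integral _ _ _); rewrite /cyl !cylinder_rcons -setIUr.
  rewrite -preimage_setU (_ : _ `|` _ = setT) ?preimage_setT ?setIT //.
  by apply/seteqP; split => // -[] _; [left|right].
- by apply/measurable_EFinP; apply: measurable_funTS.
- by move=> w _; rewrite lee_fin.
- apply/disj_setPS => w; rewrite /cyl !cylinder_rcons => -[[_ /= ->] []].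
  by [].
Qed.

(** Measurability with respect to the first [n] bits, put pointwise so that no sub-sigma-algebra or
    conditional expectation is required. *)
Definition determined n (f : T -> R) := forall w w' : T,
  (forall i, (i < n)%N -> B i w = B i w') -> f w = f w'.

Lemma integral_cylinder_cst s (f : T -> R) (r : R) :
  (forall w, cyl s w -> f w = r) ->
  (\int[P]_(w in cyl s) (f w)%:E)%E = (r * 2^-1 ^+ size s)%:E.
Proof.
move=> fr; rewrite (eq_integral (cst r%:E)); last first.
  by move=> w /set_mem /fr ->.
by rewrite EFinM -prob_cylinder integral_cst; last exact: measurable_cylinder.
Qed.

(** This is averaging over bit [n] conditionally on the earlier bits: on a cylinder of length [n]
    both [f] and [g] are constant, and bit [n] cuts it into two halves of equal probability. *)
Lemma integral_bit_step n (f g : T -> R) :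
  measurable_fun setT f -> measurable_fun setT g ->
  (forall w, 0 <= f w) -> (forall w, 0 <= g w) ->
  determined n f -> determined n g ->
  (\int[P]_w (if B n w then f w else g w)%:E =
   \int[P]_w ((f w + g w) / 2)%:E)%E.
Proof.
move=> mf mg f0 g0 df dg.
pose F w := if B n w then f w else g w; pose G w := (f w + g w) / 2.
have mF : measurable_fun setT F.
  by apply: measurable_fun_ifT => //; exact: measurable_funP.
have mG : measurable_fun setT G.
  by apply: measurable_funM; [exact: measurable_funD|exact: measurable_cst].
have F0 w : 0 <= F w by rewrite /F; case: ifP.
have G0 w : 0 <= G w by rewrite /G divr_ge0 // addr_ge0.
have cylT : cyl [::] = setT by apply/seteqP; split.
(* Induction on the number [m] of bits still to be fixed; each step splits the cylinder by its next
   bit. *)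
suff H m s : (size s + m = n)%N ->
    (\int[P]_(w in cyl s) (F w)%:E = \int[P]_(w in cyl s) (G w)%:E)%E.
  by have := H n [::] (add0n n); rewrite cylT.
elim: m s => [|m IHm] s; last first.
  move=> smn; rewrite (integral_cylinder_rcons s mF F0) (integral_cylinder_rcons s mG G0).
  by rewrite !IHm // size_rcons addSnnS.
rewrite addn0 => sn.
(* A point [w0] of the cylinder supplies the constant values of [f] and [g]; over an empty cylinder
   both integrals are 0. *)
have [[w0 sw0]|/set0P/negP] := pselect (cyl s !=set0); last first.
  by rewrite negbK => /eqP ->; rewrite !integral_set0.
have agree w : cyl s w -> forall i, (i < n)%N -> B i w = B i w0.
  by move=> sw i; rewrite -sn => ins; rewrite (sw i ins) (sw0 i ins).
have fE w : cyl s w -> f w = f w0 by move=> /agree/df.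
have gE w : cyl s w -> g w = g w0 by move=> /agree/dg.
rewrite (integral_cylinder_rcons s mF F0).
rewrite (@integral_cylinder_cst (rcons s true) _ (f w0)); last first.
  by move=> w; rewrite /cyl cylinder_rcons /F sn => -[/fE -> ->].
rewrite (@integral_cylinder_cst (rcons s false) _ (g w0)); last first.
  by move=> w; rewrite /cyl cylinder_rcons /F sn => -[/gE -> ->].
rewrite (@integral_cylinder_cst s G ((f w0 + g w0) / 2)); last first.
  by move=> w sw; rewrite /G fE // gE.
by rewrite !size_rcons -EFinD exprSr; congr (_ %:E); field.
Qed.

End fair_bits.

(** * The polarization process *)

Lemma measurable_sum_cond (R : realType) (disp : measure_display)
    (T : measurableType disp) (D : set T) (I : Type) (s : seq I) (A : pred I)
    (h : I -> T -> R) :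
  (forall i, measurable_fun D (h i)) ->
  measurable_fun D (fun x => \sum_(i <- s | A i) h i x).
Proof.
move=> mh; rewrite (_ : (fun _ => _) = fun x => \sum_(i <- [seq i <- s | A i]) h i x).
  exact: measurable_sum.
by apply/funext => x; rewrite big_filter.
Qed.

Lemma measurable_polar_minus (R : realType) (q : nat) (disp : measure_display)
    (T : measurableType disp) (X : T -> divisor q -> R) d :
  (forall i, measurable_fun setT (X^~ i)) ->
  measurable_fun setT (fun w => polar_minus (X w) d).
Proof.
move=> mX; apply: measurable_sum => d1; apply: measurable_sum_cond => d2.
exact: measurable_funM.
Qed.

Lemma measurable_polar_plus (R : realType) (q : nat) (disp : measure_display)
    (T : measurableType disp) (X : T -> divisor q -> R) d :
  (forall i, measurable_fun setT (X^~ i)) ->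
  measurable_fun setT (fun w => polar_plus (X w) d).
Proof.
move=> mX; apply: measurable_sum => d1; apply: measurable_sum_cond => d2.
exact: measurable_funM.
Qed.

Section polarization_process.
Context (R : realType) (q : nat) (hq : prime_power q)
  (eps : divisor q -> R) (heps : prob_vector eps)
  (disp : measure_display) (T : measurableType disp) (P : probability T R)
  (B : nat -> {RV P >-> bool}).
Hypotheses (hBfair : forall n, fair_bit (B n)) (hBindep : mutually_independent B).

Let E n w := polarization eps (fun i => B i w) n.

Let E_prob n w : prob_vector (E n w).
Proof. exact: prob_vector_polarization. Qed.

Let E_ext n w w' : (forall i, (i < n)%N -> B i w = B i w') -> E n w = E n w'.
Proof. exact: polarization_ext. Qed.

Lemma measurable_polarization n d : measurable_fun setT (fun w => E n w d).
Proof.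
elim: n d => [|n IHn] d; first exact: measurable_cst.
have -> : (fun w => E n.+1 w d) =
    (fun w => if B n w then polar_plus (E n w) d else polar_minus (E n w) d).
  by apply/funext => w; rewrite /E /=; case: ifP.
apply: measurable_fun_ifT; first exact: measurable_funP.
- exact: measurable_polar_plus.
- exact: measurable_polar_minus.
Qed.

(** Martingale property: the mean of the two transforms of a coordinate is that coordinate. *)
Lemma integral_polarization n d :
  (\int[P]_w (E n w d)%:E = (eps d)%:E)%E.
Proof.
elim: n => [|n <-].
  transitivity ((eps d)%:E * P setT)%E.
    exact: (integral_cst P measurableT (eps d)%:E).
  by rewrite probability_setT mule1.
transitivity (\int[P]_w (if B n w then polar_plus (E n w) d
    else polar_minus (E n w) d)%:E)%E.
  by apply: eq_integral => w _; rewrite /E /=; case: ifP.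
rewrite (@integral_bit_step _ _ _ _ B _ _ n (fun w => polar_plus (E n w) d)
  (fun w => polar_minus (E n w) d)) //.
- apply: eq_integral => w _; rewrite addrC polar_minusDplus //.
    by rewrite mulrAC mulfV ?mul1r.
  by have [] := E_prob n w.
- by apply: measurable_polar_plus => i; exact: measurable_polarization.
- by apply: measurable_polar_minus => i; exact: measurable_polarization.
- by move=> w; apply: polar_plus_ge0; have [] := E_prob n w.
- by move=> w; apply: polar_minus_ge0; have [] := E_prob n w.
- by move=> w w' /E_ext ->.
- by move=> w w' /E_ext ->.
Qed.

(** * Almost sure convergence of the tails *)

Let Z c n w := tail (E n w) c.
Let H c n w := Z c n w * (1 - Z c n w).

Let Z01 c n w : 0 <= Z c n w <= 1.
Proof. exact: tail_ge0_le1. Qed.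

Let measurable_Z c n : measurable_fun setT (Z c n).
Proof.
by apply: measurable_sum_cond => d; exact: measurable_polarization.
Qed.

Let measurable_H c n : measurable_fun setT (H c n).
Proof. by apply: measurable_funM => //; apply: measurable_funB. Qed.

Let ZS c n w : Z c n.+1 w =
  if B n w then 2 * Z c n w - Z c n w ^+ 2 else Z c n w ^+ 2.
Proof.
rewrite /Z /E /=; case: ifP => _.
  by rewrite tail_polar_plus //; have [] := E_prob n w.
by rewrite tail_polar_minus // prime_power_gt0.
Qed.

Let H0 c n w : 0 <= H c n w.
Proof. by have /andP[? ?] := Z01 c n w; rewrite mulr_ge0 // subr_ge0. Qed.

(** With [h = z (1 - z)], the values of [h] at [2 z - z^2] and at [z^2] have mean [h - h^2]. The
    identity is written as a sum to avoid subtracting extended reals. *)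
Let integral_H c n :
  (\int[P]_w (H c n w)%:E =
   \int[P]_w (H c n w ^+ 2)%:E + \int[P]_w (H c n.+1 w)%:E)%E.
Proof.
pose f w := let z := 2 * Z c n w - Z c n w ^+ 2 in z * (1 - z).
pose g w := let z := Z c n w ^+ 2 in z * (1 - z).
have mZ2 : measurable_fun setT (fun w => Z c n w ^+ 2) by exact: measurable_funX.
have mf : measurable_fun setT f.
  have m1 : measurable_fun setT (fun w => 2 * Z c n w - Z c n w ^+ 2).
    by apply: measurable_funB => //; apply: measurable_funM.
  by apply: measurable_funM => //; apply: measurable_funB.
have mg : measurable_fun setT g.
  by apply: measurable_funM => //; apply: measurable_funB.
have f0 w : 0 <= f w.
  by have /andP[? ?] := Z01 c n w; apply: mulr_ge0; nra.
have g0 w : 0 <= g w.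
  by have /andP[? ?] := Z01 c n w; apply: mulr_ge0; nra.
have -> : (\int[P]_w (H c n.+1 w)%:E = \int[P]_w ((f w + g w) / 2)%:E)%E.
  rewrite -(@integral_bit_step _ _ _ _ B _ _ n) //.
  - by apply: eq_integral => w _; rewrite /H ZS /f /g; case: ifP.
  - by move=> w w' /E_ext ww'; rewrite /f /Z ww'.
  - by move=> w w' /E_ext ww'; rewrite /g /Z ww'.
rewrite -ge0_integralD //.
- by apply: eq_integral => w _; rewrite -EFinD /H /f /g; congr (_ %:E); field.
- by move=> w _; rewrite lee_fin sqr_ge0.
- by apply/measurable_EFinP; exact: measurable_funX.
- by move=> w _; rewrite lee_fin divr_ge0 ?addr_ge0.
- apply/measurable_EFinP; apply: measurable_funM; last exact: measurable_cst.
  exact: measurable_funD.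
Qed.

(** Telescoping bounds the sum of the expectations of [h_k^2] by that of [h_0]; hence the series of
    the [h_k^2] is almost surely finite and its terms tend to 0. *)
Let ae_H_cvg0 c : {ae P, forall w, H c n w @[n --> \oo] --> (0 : R)}.
Proof.
have mH2 n : measurable_fun setT (fun w => (H c n w ^+ 2)%:E).
  by apply/measurable_EFinP; exact: measurable_funX.
have H20 n w : (0 <= (H c n w ^+ 2)%:E)%E by rewrite lee_fin sqr_ge0.
have partial n : (\sum_(0 <= k < n) \int[P]_w (H c k w ^+ 2)%:E +
    \int[P]_w (H c n w)%:E = \int[P]_w (H c 0 w)%:E)%E.
  elim: n => [|n IHn]; first by rewrite big_geq // add0e.
  by rewrite big_nat_recr //= -addeA -integral_H.
have intH0 : (\int[P]_w (H c 0 w)%:E < +oo)%E.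
  apply: (@le_lt_trans _ _ (\int[P]_w (cst 1%E w))%E).
    apply: ge0_le_integral => //.
    - by move=> w _; rewrite lee_fin.
    - exact/measurable_EFinP.
    - move=> w _; rewrite lee_fin.
      by have /andP[? ?] := Z01 c 0 w; rewrite /H; nra.
  rewrite (integral_cst P measurableT) mul1e.
  by rewrite (le_lt_trans (probability_le1 P measurableT)) // ltry.
have : P.-integrable setT (fun w => \sum_(0 <= k <oo) (H c k w ^+ 2)%:E)%E.
  apply/integrableP; split.
    exact: ge0_emeasurable_sum.
  under eq_integral do rewrite gee0_abs ?nneseries_ge0 //.
  rewrite integral_nneseries //; apply: le_lt_trans intH0.
  apply: lime_le; first by apply: is_cvg_nneseries => n _ _; exact: integral_ge0.
  apply: nearW => n; rewrite -(partial n) leeDl // integral_ge0 // => w _.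
  by rewrite lee_fin.
move=> /(integrable_ae measurableT).
apply: filterS => w /(_ Logic.I) Sfin.
have H2cvg : H c n w ^+ 2 @[n --> \oo] --> (0 : R).
  (* The remainders of the finite series tend to 0 and dominate their first terms. *)
  have tl : (\big[+%E/0%E]_(n <= k <oo) (H c k w ^+ 2)%:E @[n --> \oo] --> 0%E).
    by apply: nneseries_tail_cvg => //; rewrite ltey_eq Sfin.
  have : (H c n w ^+ 2)%:E @[n --> \oo] --> 0%:E.
    apply: (squeeze_cvge _ (cvg_cst _) tl); apply: nearW => n.
    rewrite H20 /= (nneseries_split _ 1) //.
    by rewrite addn1 big_nat1 leeDl // nneseries_ge0.
  by move=> /fine_cvg.
have -> : (fun n => H c n w) = (fun n => Num.sqrt (H c n w ^+ 2)).
  by apply/funext => n; rewrite sqrtr_sqr ger0_norm.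
rewrite -[X in _ --> X](@sqrtr0 R).
exact: (continuous_cvg _ (@sqrt_continuous R 0)).
Qed.

(** Both possible steps, [z^2 - z] and [z - z^2], have size exactly [h]. *)
Let ae_Z_cvg c : {ae P, forall w, Z c n w @[n --> \oo] --> (0 : R) \/
  Z c n w @[n --> \oo] --> (1 : R)}.
Proof.
apply: filterS (ae_H_cvg0 c) => w Hw.
apply: (@cvg01_of_small_steps _ (fun n => Z c n w)) => // n.
rewrite ZS; have /andP[z0 z1] := Z01 c n w.
by case: ifP => _; rewrite ler_norml; apply/andP; split; nra.
Qed.

(** * Convergence of the probability vectors to a unit vector *)

Lemma ae_polarization_cvg : {ae P, forall w, exists d : divisor q,
  forall i, E n w i @[n --> \oo] --> unit_vector R d i}.
Proof.
case: (hq) => p [k [pp k0 qE]].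
(* There are finitely many divisors, so one null set serves all the tails involved. *)
have : {ae P, forall w, forall d : divisor q, (Z (val d) n w @[n --> \oo] --> (0 : R) \/
  Z (val d) n w @[n --> \oo] --> (1 : R)) /\ (Z (p * val d) n w @[n --> \oo] --> (0 : R) \/
  Z (p * val d) n w @[n --> \oo] --> (1 : R))}.
  by apply: filter_forall => d; apply: filterI; exact: ae_Z_cvg.
apply: filterS => w Hw.
have ecvg d : E n w d @[n --> \oo] --> (0 : R) \/ E n w d @[n --> \oo] --> (1 : R).
  have Eeq : (fun n => E n w d) = (fun n => Z (val d) n w - Z (p * val d) n w).
    by apply/funext => n; rewrite (tail_sub _ _ pp qE).
  have E0 n : 0 <= E n w d by have [] := E_prob n w.
  have cvgE (a b : R) : Z (val d) n w @[n --> \oo] --> a ->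
      Z (p * val d) n w @[n --> \oo] --> b -> E n w d @[n --> \oo] --> a - b.
    by rewrite Eeq => za zb; exact: cvgB.
  have [[z1|z1] [z2|z2]] := Hw d; have := cvgE _ _ z1 z2;
    rewrite ?subr0 ?subrr ?sub0r; [by left| |by right|by left] => EN1.
  (* The remaining combination of tail limits is [0 - 1], impossible for a limit of nonnegative
     numbers. *)
  have : 0 <= lim (E n w d @[n --> \oo]).
    by apply: limr_ge; [exact: cvgP EN1|exact: nearW].
  by rewrite (cvg_lim _ EN1) // ler0N1.
(* If coordinate [d] tends to 1, each other one is squeezed between 0 and [1 - E n w d]. If none
   does, all tend to 0, although they sum to 1. *)
have [[d Ed]|noE] := pselect (exists d, E n w d @[n --> \oo] --> (1 : R)).
  exists d => i; rewrite /unit_vector; case: eqVneq => [->//|id].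
  have Ed1 : 1 - E n w d @[n --> \oo] --> (0 : R).
    by rewrite -[X in _ --> X](subrr 1); apply: cvgB => //; exact: cvg_cst.
  apply: (squeeze_cvgr _ (cvg_cst _) Ed1); apply: nearW => n.
  have [E0 E1] := E_prob n w.
  rewrite E0 /= lerBrDr -E1 (bigD1 i) //= lerD2l (bigD1 d) ?lerDl ?sumr_ge0 //=.
  by rewrite eq_sym.
have : \sum_i E n w i @[n --> \oo] --> \sum_(i : divisor q) (0 : R).
  apply: cvg_big => [|i _]; first exact: add_continuous.
  have [//|Ei] := ecvg i.
  by case: noE; exists i.
rewrite big1 // (_ : (fun n => _) = cst (1 : R)); last first.
  by apply/funext => n; have [] := E_prob n w.
move=> /(cvg_lim (@Rhausdorff R)); rewrite lim_cst; last exact: Rhausdorff.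
by move=> /eqP; rewrite oner_eq0.
Qed.

End polarization_process.

(** * The limit channel and the law of its divisor *)

Theorem theorem2 (R : realType) (q : nat) (hq2 : (2 <= q)%N)
    (hq : prime_power q)
    (eps : divisor q -> R) (heps : prob_vector eps)
    (disp : measure_display) (T : measurableType disp) (P : probability T R)
    (B : nat -> {RV P >-> bool})
    (hBfair : forall n, fair_bit (B n)) (hBindep : mutually_independent B) :
  exists Einf : T -> divisor q -> R,
    [/\ forall d, measurable_fun setT (fun w => Einf w d),
        forall w, prob_vector (Einf w),
        {ae P, forall w, forall d,
           polarization eps (fun n => B n w) n d @[n --> \oo] --> Einf w d} &
        forall d,
          let A := [set w | forall alpha : \bar R, (0 <= alpha)%E ->
                      sym_capacity (erasure_channel (Einf w)) alpha
                      = ln (val d)%:R] in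
          measurable A /\ P A = (eps d)%:E].
Proof.
have q0 := prime_power_gt0 hq.
pose E n w := polarization eps (fun i => B i w) n.
(* The divisor 1 is the default on the exceptional null set [N], which makes the limit a probability
   vector at every point. *)
have [d0 _] := ex_divisor q0 (dvd1n q).
have [N [mN PN0 cvgN]] := ae_polarization_cvg hq heps hBfair hBindep.
have /choice[D hD] w : exists d : divisor q,
    (N w -> d = d0) /\ (~ N w -> forall i, E n w i @[n --> \oo] --> unit_vector R d i).
  have [Nw|Nw] := pselect (N w); first by exists d0; split.
  have [[d Ed]|noE] := pselect (exists d : divisor q,
    forall i, E n w i @[n --> \oo] --> unit_vector R d i); first by exists d; split.
  by exfalso; apply: Nw; exact: cvgN.
(* [D] comes from choice, so measurability is obtained from a limit: replacing [E n] on [N] by the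
   default vector gives measurable functions that converge everywhere. *)
have mD i : measurable_fun setT (fun w => unit_vector R (D w) i).
  apply: (@measurable_fun_cvg _ _ _ _
    (fun n w => \1_N w * unit_vector R d0 i + \1_(~` N) w * E n w i)).
    move=> n; apply: measurable_funD; apply: measurable_funM.
    + exact: measurable_indic.
    + exact: measurable_cst.
    + by apply: measurable_indic; exact: measurableC.
    + exact: measurable_polarization.
  move=> w _; have [DN DE] := hD w; have [Nw|Nw] := pselect (N w).
    rewrite DN //; apply: cvg_near_cst; apply: nearW => n.
    by rewrite !indicE in_setC !mem_set //= mul1r mul0r addr0.
  rewrite (_ : (fun n => _) = E^~ w ^~ i); first exact: DE.
  by apply/funext => n; rewrite !indicE in_setC memNset //= mul0r mul1r add0r.
have aeD : {ae P, forall w, forall i, E n w i @[n --> \oo] --> unit_vector R (D w) i}.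
  exists N; split=> // w; apply: contra_notP => Nw.
  by have [_] := hD w; apply.
exists (fun w => unit_vector R (D w)); split => //.
  move=> w; split=> [i|]; first by rewrite /unit_vector ler0n.
  by rewrite (bigD1 (D w)) //= /unit_vector eqxx big1 ?addr0 // => i /negbTE ->.
move=> d A.
(* Order [+oo] alone identifies the divisor, by injectivity of [ln]; conversely the noiseless
   channel has capacity [ln d] at every order. *)
have AE : A = (fun w => unit_vector R (D w) d) @^-1` [set 1].
  apply/seteqP; split=> w; rewrite /A /unit_vector /=.
    move=> /(_ +oo%E (leey _)); rewrite sym_capacity_unit_vector ?leey //.
    have pos (d' : divisor q) : (val d')%:R \is @Num.pos R.
      by rewrite posrE ltr0n (dvdn_gt0 q0) // val_divisor_dvd.
    move=> /(ln_inj (pos _) (pos _))/eqP; rewrite eqr_nat => /eqP/val_inj ->.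
    by rewrite eqxx.
  case: eqVneq => [->|_] /eqP; last by rewrite eq_sym oner_eq0.
  by move=> _ alpha a0; exact: sym_capacity_unit_vector.
have mA : measurable A.
  by rewrite AE -[X in measurable X]setTI; apply: mD => //; exact: measurable_set1.
split=> //.
(* The limiting coordinate takes only the values 0 and 1, so it is the indicator of [A]. *)
have -> : P A = (\int[P]_w (unit_vector R (D w) d)%:E)%E.
  rewrite -[A]setIT -integral_indic //; apply: eq_integral => w _.
  rewrite indicE; case: (asboolP (A w)) => Aw.
    rewrite mem_set //; by move: Aw; rewrite AE /= => ->.
  rewrite memNset //; move: Aw; rewrite AE /= /unit_vector; by case: eqVneq.
have mE n : measurable_fun setT (fun w => (E n w d)%:E).
  by apply/measurable_EFinP; exact: measurable_polarization.
have mEinf : measurable_fun setT (fun w => (unit_vector R (D w) d)%:E).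
  exact/measurable_EFinP.
have EFin_cvg : {ae P, forall w, setT w ->
    (E n w d)%:E @[n --> \oo] --> (unit_vector R (D w) d)%:E}.
  apply: filterS aeD => w Ew _.
  by apply: cvg_EFin; [exact: nearW|exact: Ew].
have E_le1 : {ae P, forall w, forall n, setT w -> (`|(E n w d)%:E| <= (1 : R)%:E)%E}.
  apply: aeW => w n _; rewrite abse_EFin lee_fin.
  have [E0 E1] := prob_vector_polarization (B ^~ w) n hq heps.
  by rewrite ger0_norm ?E0 // -E1 (bigD1 d) //= lerDl sumr_ge0.
(* The coordinates are bounded by 1 and their integrals all equal [eps d], so the limit has this
   integral too. *)
have [_ _] := dominated_convergence measurableT mE mEinf EFin_cvg
  (finite_measure_integrable_cst P 1 measurableT) E_le1.
rewrite (_ : [sequence _]_n = cst (eps d)%:E); last first.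
  by apply/funext => n; exact: integral_polarization.
by move=> /(cvg_lim (@ereal_hausdorff R)); rewrite lim_cst //; exact: ereal_hausdorff.
Qed.
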